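(* For any integer $d \geq 2$, let $r$ and $s$ be positive integers such that $d(s-1) < (2^d - 1)r$. Then $$\operatorname{ex}_{d}(n,K_{2,\ldots,2}^{(d)}) = \Omega\left(n^{d - \frac{r}{s}}\right),$$ where the implied constant may depend on $d$, $r$ and $s$ but not on $n$.
   Context: For a $d$-uniform hypergraph $\mathcal{H}$, $\operatorname{ex}_d(n,\mathcal{H})$ denotes the maximum number of edges in a $d$-uniform hypergraph on $n$ vertices containing no copy of $\mathcal{H}$. $K_{2,\ldots,2}^{(d)}$ denotes the complete $d$-partite $d$-uniform hypergraph with exactly two vertices in each of its $d$ parts (so it has $2d$ vertices and $2^d$ edges). *)

(* Defs.v *)
From mathcomp Require Import all_boot.

Set Implicit Arguments.
Unset Strict Implicit.
Unset Printing Implicit Defensive.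

(* A hypergraph on the vertex type T is its edge set H : {set {set T}}. *)

Definition uniform (d : nat) (T : finType) (H : {set {set T}}) : bool :=
  [forall e in H, #|e| == d].

(* Copies are not required to be induced. *)
Definition contains_copy (S T : finType)
    (H : {set {set S}}) (G : {set {set T}}) : bool :=
  [exists f : {ffun S -> T}, injectiveb f && [forall e in H, f @: e \in G]].

Definition turan_ex (d n : nat) (S : finType) (H : {set {set S}}) : nat :=
  \max_(G : {set {set 'I_n}} | uniform d G && ~~ contains_copy H G) #|G|.

(* The i-th part is the set of vertices with first component i. *)
Definition complete_partite (d t : nat) : {set {set ('I_d * 'I_t)}} :=
  [set e : {set 'I_d * 'I_t} |
    [forall i : 'I_d, #|[set v in e | v.1 == i]| == 1]].

(* Main.v *)
(* Let F be a field with q = 2^k elements and T a random multilinear map from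
   (F^s)^d to F^r; take as edges the tuples with T(v_1, ..., v_d) = a, for a fixed
   a <> 0.  About q^(ds-r) edges are expected.  In a box (v_i, w_i) of edges each
   pair v_i, w_i is linearly independent (otherwise scaling would force
   v_i = w_i), so the 2^d tensors involved are independent and the box occurs
   with probability q^(-r 2^d).  Moreover T = a on the whole product of the affine
   lines v_i w_i, so an edge lying in a box lies in at least (q-1)^d of them.  The
   expected number of such bad edges is therefore O(q^(2ds-d-r 2^d)), which the
   condition d(s-1) < (2^d-1)r makes O(q^(ds-r-1)): deleting them leaves
   Omega(q^(ds-r)) edges on d q^s vertices. *)

Require Import Defs.
From mathcomp Require Import all_boot all_order all_algebra all_field.
From mathcomp Require Import zify ring.

Set Implicit Arguments.
Unset Strict Implicit.
Unset Printing Implicit Defensive.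

Import GRing.Theory.
Local Open Scope ring_scope.

(** Injections both ways between any two fibres make all fibres equinumerous, so each has density
    [1/#|W|] in [U]. *)
Lemma card_fiber_transport (U W : finType) (L : U -> W) :
    (forall w w', exists2 h : U -> U, injective h &
       forall u, L u = w -> L (h u) = w') ->
  forall w, (#|[set u | L u == w]| * #|W| = #|U|)%N.
Proof.
move=> LP w.
have le_fib w1 w2 : (#|[set u | L u == w1]| <= #|[set u | L u == w2]|)%N.
  have [h hI hP] := LP w1 w2.
  rewrite -(card_imset _ hI); apply/subset_leq_card/subsetP => _ /imsetP[u + ->].
  by rewrite !inE => /eqP/hP->.
rewrite -[RHS]sum1_card (partition_big L predT) //=.
under eq_bigr => w' _.
  have -> : (\sum_(u | L u == w') 1 = #|[set u | L u == w]|)%N.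
    rewrite sum1dep_card; apply/eqP.
    by rewrite eqn_leq !le_fib.
  over.
by rewrite sum_nat_const mulnC.
Qed.

(** * Counting multilinear maps with prescribed values *)

Section MultilinearMaps.

Variables (F : finFieldType) (d s r : nat).

Let idx := {ffun 'I_d -> 'I_s}.
Let coefs := {ffun idx -> 'rV[F]_r}.

(** [C] lists the values on tuples of basis vectors, so a uniform [C] is a uniform random
    multilinear map. *)
Definition mleval (C : coefs) (v : 'I_d -> 'rV[F]_s) : 'rV[F]_r :=
  \sum_(p : idx) (\prod_i v i 0 (p i)) *: C p.

Lemma eq_mleval C v w : v =1 w -> mleval C v = mleval C w.
Proof.
by move=> vw; apply: eq_bigr => p _; congr (_ *: _); apply: eq_bigr => i _; rewrite vw.
Qed.

Lemma mleval_add C D v : mleval (C + D) v = mleval C v + mleval D v.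
Proof.
by rewrite /mleval -big_split; apply: eq_bigr => p _; rewrite ffunE scalerDr.
Qed.

Lemma mleval_eq0 C v i : v i = 0 -> mleval C v = 0.
Proof.
move=> vi0; apply: big1 => p _.
by rewrite (bigD1 i) //= vi0 mxE mul0r scale0r.
Qed.

Lemma mleval_comb t C (V : 'I_d -> 'M[F]_(t, s)) (x : 'I_d -> 'rV[F]_t) :
  mleval C (fun i => x i *m V i) =
  \sum_(e : {ffun 'I_d -> 'I_t})
     (\prod_i x i 0 (e i)) *: mleval C (fun i => row (e i) (V i)).
Proof.
rewrite /mleval.
under [RHS]eq_bigr do rewrite scaler_sumr.
rewrite exchange_big /=; apply: eq_bigr => p _.
under eq_bigr do rewrite mxE.
rewrite bigA_distr_bigA scaler_suml; apply: eq_bigr => e _.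
rewrite scalerA -big_split /=; congr (_ *: _).
by apply: eq_bigr => i _; rewrite mxE.
Qed.

(** Serves twice: affine combinations of the rows keep the value [a], and a vanishing combination in
    one part must have coordinate sum 0 when [a] is nonzero. *)
Lemma mleval_comb_const t C (V : 'I_d -> 'M[F]_(t, s)) (x : 'I_d -> 'rV[F]_t) a :
    (forall e : {ffun 'I_d -> 'I_t}, mleval C (fun i => row (e i) (V i)) = a) ->
  mleval C (fun i => x i *m V i) = (\prod_i \sum_j x i 0 j) *: a.
Proof.
move=> Ha; rewrite mleval_comb bigA_distr_bigA scaler_suml.
by apply: eq_bigr => e _; rewrite Ha.
Qed.

(* The [t ^ d] tensors formed from the rows of the [V i] are independent: the
   tensor product of right inverses of the [V i] is a right inverse. *)
Lemma card_mleval_rows t (V : 'I_d -> 'M[F]_(t, s)) (a : 'rV[F]_r) :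
    (forall i, row_free (V i)) ->
  (#|[set C : coefs | [forall e : {ffun 'I_d -> 'I_t},
        mleval C (fun i => row (e i) (V i)) == a]]| * #|F| ^ (r * t ^ d)
   = #|{: coefs}|)%N.
Proof.
move=> Vfree.
have Vinv i : exists B, V i *m B == 1%:M.
  by have /row_freeP[B] := Vfree i; exists B; apply/eqP.
pose B i := xchoose (Vinv i).
have BP i : V i *m B i = 1%:M by apply/eqP/(xchooseP (Vinv i)).
pose W := {ffun {ffun 'I_d -> 'I_t} -> 'rV[F]_r}.
pose L (C : coefs) : W := [ffun e : {ffun 'I_d -> 'I_t} => mleval C (fun i => row (e i) (V i))].
pose G (w : W) : coefs :=
  [ffun p : idx => \sum_(e : {ffun 'I_d -> 'I_t}) (\prod_i B i (p i) (e i)) *: w e].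
have LD C D : L (C + D) = L C + L D.
  by apply/ffunP => e; rewrite !ffunE mleval_add.
have GK w : L (G w) = w.
  apply/ffunP => e; rewrite ffunE /mleval.
  under eq_bigr do rewrite ffunE scaler_sumr.
  rewrite exchange_big /=.
  have E (e' : {ffun 'I_d -> 'I_t}) : \sum_(p : idx) (\prod_i row (e i) (V i) 0 (p i)) *:
      ((\prod_i B i (p i) (e' i)) *: w e') = (e == e')%:R *: w e'.
    under eq_bigr do rewrite scalerA -big_split /=.
    rewrite -scaler_suml -(bigA_distr_bigA (fun i j => row (e i) (V i) 0 j * B i j (e' i))).
    congr (_ *: _).
    have F1 i : \sum_j row (e i) (V i) 0 j * B i j (e' i) = (e i == e' i)%:R.
      transitivity ((V i *m B i) (e i) (e' i)); last by rewrite BP mxE.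
      by rewrite mxE; apply: eq_bigr => j _; rewrite mxE.
    under eq_bigr do rewrite F1.
    case: eqP => [->|ne]; first by apply: big1 => i _; rewrite eqxx.
    have [i nei] : exists i, e i != e' i.
      apply/existsP; rewrite -negb_forall; apply/negP => /forallP H.
      by apply: ne; apply/ffunP => i; apply/eqP.
    by rewrite (bigD1 i) //= (negbTE nei) mul0r.
  under eq_bigr do rewrite E.
  rewrite (bigD1 e) //= eqxx scale1r big1 ?addr0 // => e' ne.
  by rewrite eq_sym (negbTE ne) scale0r.
have := @card_fiber_transport coefs W L _ [ffun=> a].
rewrite [#|{ffun {ffun 'I_d -> 'I_t} -> _}|]card_ffun card_mx mul1n !card_ffun.
rewrite !card_ord -expnM mulnC => <-.
  rewrite mulnC; congr (_ * _)%N; apply: eq_card => C; rewrite !inE.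
  apply/forallP/eqP => [H|H e]; last by move/ffunP/(_ e): H; rewrite !ffunE => ->.
  by apply/ffunP => e; rewrite !ffunE; apply/eqP.
(* Translation by a preimage of [w' - w] carries the fibre over [w] into the fibre over [w']. *)
move=> w w'; exists (fun u => u + G (w' - w)); first exact: addIr.
by move=> u <-; rewrite LD GK addrC subrK.
Qed.

Lemma card_mleval_eq (v : 'I_d -> 'rV[F]_s) (a : 'rV[F]_r) :
    (forall i, v i != 0) ->
  (#|[set C : coefs | mleval C v == a]| * #|F| ^ r = #|{: coefs}|)%N.
Proof.
move=> v0; rewrite -(@card_mleval_rows 1 v a) => [|i]; last first.
  by rewrite /row_free rank_rV v0.
rewrite exp1n muln1; congr (_ * _)%N; apply: eq_card => C; rewrite !inE.
have E (e : {ffun 'I_d -> 'I_1}) : mleval C (fun i => row (e i) (v i)) = mleval C v.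
  by apply: eq_mleval => i; rewrite ord1; apply/rowP => j; rewrite mxE.
apply/eqP/forallP => [H e|/(_ [ffun=> 0])]; last by rewrite E => /eqP.
by rewrite E H.
Qed.

(** * Boxes and bad edges *)

Section Boxes.

Variables (a : 'rV[F]_r) (a0 : a != 0).

Definition edges (C : coefs) : {set {ffun 'I_d -> 'rV[F]_s}} :=
  [set v : {ffun 'I_d -> 'rV[F]_s} | mleval C v == a].

(* The two rows of [V i] are the two vertices of the box in the i-th part. *)
Definition boxes (C : coefs) : {set {ffun 'I_d -> 'M[F]_(2, s)}} :=
  [set V : {ffun 'I_d -> 'M[F]_(2, s)} |
    [forall i, row 0 (V i) != row 1 (V i)] &&
    [forall e : {ffun 'I_d -> 'I_2}, mleval C (fun i => row (e i) (V i)) == a]].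

(** Marking only the base corner loses nothing: swapping the rows of suitable [V i] turns any corner
    into the base. *)
Definition bad_edges (C : coefs) : {set {ffun 'I_d -> 'rV[F]_s}} :=
  [set [ffun i => row 0 (V i)] | V : {ffun 'I_d -> 'M[F]_(2, s)} in boxes C].

Lemma boxesP C (V : {ffun 'I_d -> 'M[F]_(2, s)}) :
  reflect ((forall i, row 0 (V i) != row 1 (V i)) /\
           forall e : {ffun 'I_d -> 'I_2}, mleval C (fun i => row (e i) (V i)) = a)
          (V \in boxes C).
Proof.
rewrite inE; apply: (iffP andP) => -[H1 H2]; split.
- exact/forallP.
- by move=> e; apply/eqP; move/forallP: H2.
- exact/forallP.
- by apply/forallP => e; apply/eqP.
Qed.

Lemma mul_rV2 (x : 'rV[F]_2) (M : 'M[F]_(2, s)) :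
  x *m M = x 0 0 *: row 0 M + x 0 1 *: row 1 M.
Proof.
by apply/rowP => j; rewrite !mxE !big_ord_recl big_ord0 addr0 /= ?mxE;
  congr (_ * _ + _ * _); congr (_ _ _); apply/val_inj.
Qed.

Lemma sum_rV2 (x : 'rV[F]_2) : \sum_j x 0 j = x 0 0 + x 0 1.
Proof.
by rewrite !big_ord_recl big_ord0 addr0; congr (_ + x 0 _); apply/val_inj.
Qed.

Lemma box_row_free C V : V \in boxes C -> forall i, row_free (V i).
Proof.
move=> /boxesP[Vd VP] i; apply: inj_row_free => x xV0.
(* Base vertices outside part [i] have coordinate sum 1, so evaluation at [y] gives
   [0 = (x 0 0 + x 0 1) *: a]. *)
pose y j : 'rV[F]_2 := if j == i then x else delta_mx 0 0.
have := mleval_comb_const y VP.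
rewrite (@mleval_eq0 _ _ i) ?/y ?eqxx // => /esym/eqP.
rewrite scaler_eq0 (negbTE a0) orbF (bigD1 i) //= eqxx [X in _ * X]big1 => [|j ji]; last first.
  by rewrite (negbTE ji) sum_rV2 !mxE !eqxx /= addr0.
rewrite mulr1 sum_rV2 addrC addr_eq0 => /eqP x1.
move: xV0; rewrite mul_rV2 x1 scaleNr -scalerBr => /eqP.
rewrite scaler_eq0 subr_eq0 (negbTE (Vd i)) orbF => /eqP x0.
apply/rowP => j; rewrite mxE; have : (j == 0) || (j == 1) by case: j => [[|[]]].
by case/orP => /eqP->; rewrite ?x1 x0 ?oppr0.
Qed.

(** The row operation that fixes the first vertex and moves the second along their affine line to
    parameter [t]. *)
Definition slide (t : F) : 'M[F]_2 :=
  \matrix_(i, j) if i == 0 then (j == 0)%:R else if j == 0 then 1 - t else t.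

Lemma row0_slide t (M : 'M[F]_(2, s)) : row 0 (slide t *m M) = row 0 M.
Proof. by rewrite row_mul mul_rV2 !mxE !eqxx /= scale1r scale0r addr0. Qed.

Lemma row1_slide t (M : 'M[F]_(2, s)) :
  row 1 (slide t *m M) = row 0 M + t *: (row 1 M - row 0 M).
Proof.
by rewrite row_mul mul_rV2 !mxE /= scalerBl scale1r scalerBr -addrA [- _ + _]addrC.
Qed.

Lemma sum_slide t i : \sum_j row i (slide t) 0 j = 1.
Proof.
rewrite sum_rV2 !mxE /=; case: (i == 0); first by rewrite addr0.
by rewrite subrK.
Qed.

Lemma slide_box C V (t : {ffun 'I_d -> F}) : V \in boxes C -> (forall i, t i != 0) ->
  [ffun i => slide (t i) *m V i] \in boxes C.
Proof.
move=> /boxesP[Vd VP] t0; apply/boxesP; split=> [i|e].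
  rewrite ffunE row0_slide row1_slide -subr_eq0 opprD addNKr oppr_eq0.
  by rewrite scaler_eq0 negb_or t0 subr_eq0 eq_sym Vd.
under eq_mleval do rewrite ffunE row_mul.
rewrite (mleval_comb_const _ VP) big1 ?scale1r // => i _.
exact: sum_slide.
Qed.

(* A multilinear map constant on the corners of a box is constant on the whole
   product of affine lines, so a bad edge is the base of many boxes. *)
Lemma card_bad_edges C : (#|bad_edges C| * #|F|.-1 ^ d <= #|boxes C|)%N.
Proof.
have ex_box v : v \in bad_edges C ->
    exists V, (V \in boxes C) && (v == [ffun i => row 0 (V i)]).
  by case/imsetP => V VB ->; exists V; rewrite VB eqxx.
pose bx v : {ffun 'I_d -> 'M[F]_(2, s)} :=
  odflt 0 [pick V | (V \in boxes C) && (v == [ffun i => row 0 (V i)])].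
have bxP v : v \in bad_edges C ->
    bx v \in boxes C /\ v = [ffun i => row 0 (bx v i)].
  move=> vB; rewrite /bx; case: pickP => [V /andP[? /eqP]|no] //=.
  by have [V] := ex_box v vB; rewrite no.
pose T : {set {ffun 'I_d -> F}} := [set t in ffun_on (predC1 0)].
have cT : #|T| = (#|F|.-1 ^ d)%N by rewrite cardsE card_ffun_on cardC1 card_ord.
pose h (z : {ffun 'I_d -> 'rV[F]_s} * {ffun 'I_d -> F}) :=
  [ffun i => slide (z.2 i) *m bx z.1 i].
rewrite -cT -cardsX -(card_in_imset (f := h)).
  apply/subset_leq_card/subsetP => _ /imsetP[[v t] /setXP[/= vB tT] ->].
  apply: slide_box; first by case: (bxP v vB).
  by move=> i; move: tT; rewrite inE => /ffun_onP/(_ i).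
(* Rows 0 recover [v], hence the chosen box; rows 1 then recover [t], as the lines have nonzero
   directions. *)
move=> [v t] [v' t'] /setXP[/= vB tT] /setXP[/= v'B t'T] /ffunP E.
have vv' : v = v'.
  have [_ ->] := bxP v vB; have [_ ->] := bxP v' v'B.
  apply/ffunP => i; rewrite !ffunE.
  by have := E i; rewrite !ffunE /= => /(congr1 (row 0)); rewrite !row0_slide.
move: E; rewrite -vv' => E; congr (_, _); apply/ffunP => i.
have := E i; rewrite !ffunE /= => /(congr1 (row 1)); rewrite !row1_slide.
move/addrI => /eqP; rewrite -subr_eq0 -scalerBl scaler_eq0.
have [/boxesP[/(_ i) Vd _] _] := bxP v vB.
by rewrite [X in _ || X]subr_eq0 [X in _ || X]eq_sym (negbTE Vd) orbF subr_eq0 => /eqP.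
Qed.

(** * First moments and deletion *)

Lemma sum_card_edges :
  ((\sum_(C : coefs) #|edges C|) * #|F| ^ r
     >= (#|F| ^ s).-1 ^ d * #|{: coefs}|)%N.
Proof.
have -> : (\sum_(C : coefs) #|edges C| =
    \sum_(v : {ffun 'I_d -> 'rV[F]_s}) #|[set C : coefs | mleval C v == a]|)%N.
  under eq_bigr do rewrite -sum1dep_card big_mkcond.
  rewrite exchange_big; apply: eq_bigr => v _.
  by rewrite -sum1dep_card [RHS]big_mkcond.
rewrite big_distrl /=.
have <- : #|[pred v : {ffun 'I_d -> 'rV[F]_s} | v \in ffun_on (predC1 0)]|
    = ((#|F| ^ s).-1 ^ d)%N.
  by rewrite card_ffun_on cardC1 card_mx mul1n card_ord.
(* Only tuples without zero entries are kept; each is an edge with probability [q^(-r)]. *)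
rewrite -sum_nat_const [leqRHS](bigID (mem (ffun_on (predC1 0)))) /=.
apply: leq_trans (leq_addr _ _); apply: leq_sum => v /ffun_onP vP.
by rewrite card_mleval_eq // => i; have := vP i; rewrite inE.
Qed.

(** A [V] that is a box for no map contributes nothing; any other is row-free, so its corner values
    are independent and uniform. *)
Lemma sum_card_boxes :
  ((\sum_(C : coefs) #|boxes C|) * #|F| ^ (r * 2 ^ d)
     <= #|F| ^ (2 * s * d) * #|{: coefs}|)%N.
Proof.
have -> : (\sum_(C : coefs) #|boxes C| =
    \sum_(V : {ffun 'I_d -> 'M[F]_(2, s)}) #|[set C : coefs | V \in boxes C]|)%N.
  under eq_bigr do rewrite -sum1_card big_mkcond.
  rewrite exchange_big; apply: eq_bigr => v _.
  by rewrite -sum1dep_card [RHS]big_mkcond.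
rewrite big_distrl /=.
have <- : #|{ffun 'I_d -> 'M[F]_(2, s)}| = (#|F| ^ (2 * s * d))%N.
  by rewrite card_ffun card_mx card_ord -expnM.
rewrite -sum_nat_const; apply: leq_sum => V _.
have [->|[C0]] := set_0Vmem [set C : coefs | V \in boxes C].
  by rewrite cards0.
rewrite inE => /box_row_free VF.
rewrite -(card_mleval_rows a VF) leq_mul2r; apply/orP; right.
apply/subset_leq_card/subsetP => C; rewrite !inE => /andP[_].
by [].
Qed.

Lemma exists_many_good_edges :
    (0 < s)%N -> (d * (s - 1) < (2 ^ d - 1) * r)%N -> (2 ^ (2 * d).+1 <= #|F|)%N ->
  exists C : coefs, (#|F| ^ (s * d) <= 2 ^ d.+1 * #|F| ^ r * #|edges C :\: bad_edges C|)%N.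
Proof.
move=> s0 drs q_big.
set q := #|F|; pose U := #|{: coefs}|.
have q2 : (1 < q)%N by apply: leq_trans q_big; rewrite -{1}(expn1 2) leq_exp2l.
have q0 : (0 < q)%N by apply: ltnW.
have d0 : (0 < d)%N by move: drs; case: (d).
pose E := (\sum_(C : coefs) #|edges C|)%N.
pose B := (\sum_(C : coefs) #|bad_edges C|)%N.
have half m : (1 < m)%N -> (m <= 2 * m.-1)%N by lia.
(* On average, edges reach twice the target and bad edges ([HB]) cost at most one target. *)
have HE : (2 * (q ^ (s * d) * U) <= 2 ^ d.+1 * q ^ r * E)%N.
  rewrite expnS -!mulnA leq_mul2l /=.
  apply: (@leq_trans (2 ^ d * ((q ^ s).-1 ^ d * U))).
    rewrite expnM mulnA leq_mul2r -expnMn leq_exp2r ?half ?orbT //.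
    by rewrite -(expn0 q) ltn_exp2l.
  by rewrite leq_mul2l [X in (_ <= X)%N]mulnC sum_card_edges orbT.
have HB : (2 ^ d.+1 * q ^ r * B <= q ^ (s * d) * U)%N.
  have B1 : (B * q.-1 ^ d * q ^ (r * 2 ^ d) <= q ^ (2 * s * d) * U)%N.
    apply: leq_trans sum_card_boxes; rewrite leq_mul2r; apply/orP; right.
    by rewrite big_distrl; apply: leq_sum => C _; exact: card_bad_edges.
  have B2 : (B * q ^ d * q ^ (r * 2 ^ d) <= 2 ^ d * (q ^ (2 * s * d) * U))%N.
    apply: leq_trans (leq_mul (leqnn (2 ^ d)) B1).
    rewrite !mulnA leq_mul2r [(2 ^ d * B)%N]mulnC -mulnA -expnMn.
    apply/orP; right; rewrite leq_mul2l; apply/orP; right.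
    by rewrite leq_exp2r // half.
  (* This is exactly the hypothesis [drs]; its strictness yields the spare factor [q] in [r.+1]. *)
  have expo : (2 * s * d + r.+1 <= s * d + (d + r * 2 ^ d))%N.
    have : (0 < 2 ^ d)%N by rewrite expn_gt0.
    move: drs; set k := (2 ^ d)%N; nia.
  have B3 : (q ^ (2 * s * d) * (q ^ r.+1 * B) <= q ^ (2 * s * d) * (2 ^ d * q ^ (s * d) * U))%N.
    rewrite mulnA -expnD.
    apply: leq_trans (leq_mul (leq_pexp2l q0 expo) (leqnn B)) _.
    rewrite !expnD -mulnA [(q ^ d * _ * B)%N]mulnC [(B * _)%N]mulnA.
    apply: leq_trans (leq_mul (leqnn _) B2) _.
    by apply/eq_leq; ring.
  rewrite leq_pmul2l ?expn_gt0 ?q0 // in B3.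
  (* The spare [q] absorbs the constant [2 ^ (2 * d).+1]. *)
  have B4 : (2 ^ d * (2 ^ d.+1 * q ^ r * B) <= 2 ^ d * (q ^ (s * d) * U))%N.
    rewrite [leqRHS]mulnA; apply: leq_trans B3.
    rewrite !mulnA -expnD addnS addnn -mul2n (expnS q) leq_mul2r leq_mul2r q_big.
    by rewrite !orbT.
  by rewrite leq_pmul2l ?expn_gt0 // in B4.
have EBG : (E <= B + \sum_(C : coefs) #|edges C :\: bad_edges C|)%N.
  rewrite -big_split; apply: leq_sum => C _.
  by rewrite -(cardsID (bad_edges C)) leq_add2r subset_leq_card ?subsetIr.
apply/existsP; apply: contraT; rewrite negb_exists => /forallP none.
have U0 : (0 < U)%N by apply/card_gt0P; exists 0.
(* If every [C] failed, each would fall short by at least 1, hence by [U > 0] in total. *)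
have : (2 ^ d.+1 * q ^ r * (\sum_(C : coefs) #|edges C :\: bad_edges C|) + U
        <= q ^ (s * d) * U)%N.
  rewrite big_distrr /= {1}/U -[X in (_ + X)%N]sum1_card -big_split /=.
  rewrite [leqRHS]mulnC -sum_nat_const; apply: leq_sum => C _.
  by rewrite addn1 ltnNge.
have := leq_mul (leqnn (2 ^ d.+1 * q ^ r)%N) EBG.
rewrite mulnDr => /(leq_trans HE).
lia.
Qed.

End Boxes.
End MultilinearMaps.

(** * From tuples to hypergraphs *)

(** [G] is padded with isolated vertices; as every vertex of [H] lies in an edge, a copy avoids the
    padding and pulls back to [T]. *)
Lemma turan_ex_ge (S T : finType) (d n : nat) (H : {set {set S}}) (G : {set {set T}}) :
    (#|T| <= n)%N -> (forall x, exists2 e, e \in H & x \in e) ->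
    uniform d G -> ~~ contains_copy H G ->
  (#|G| <= turan_ex d n H)%N.
Proof.
move=> Tn Hcov Gd GH.
pose h (x : T) : 'I_n := widen_ord Tn (enum_rank x).
have hI : injective h.
  by move=> x y /(congr1 val) /= /val_inj; apply: enum_rank_inj.
pose G' := [set h @: e | e : {set T} in G].
have -> : #|G| = #|G'| by rewrite card_imset //; apply: imset_inj.
apply: (leq_bigmax_cond (F := fun G : {set {set 'I_n}} => #|G|)).
apply/andP; split.
  apply/forall_inP => _ /imsetP[e eG ->]; rewrite card_imset //.
  exact: (forall_inP Gd).
apply: contra GH => /existsP[f /andP[/injectiveP fI /forall_inP fH]].
have fx x : exists y, h y == f x.
  have [e eH xe] := Hcov x; have /imsetP[e' _ fe] := fH e eH.
  have : f x \in f @: e by apply: imset_f.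
  by rewrite fe => /imsetP[y _ ->]; exists y.
pose g := [ffun x => xchoose (fx x)].
have gP x : h (g x) = f x by rewrite ffunE; apply/eqP/(xchooseP (fx x)).
apply/existsP; exists g; apply/andP; split.
  by apply/injectiveP => x y gxy; apply: fI; rewrite -!gP gxy.
apply/forall_inP => e eH; have /imsetP[e' e'G fe] := fH e eH.
suff -> : g @: e = e' by [].
apply: (imset_inj hI); rewrite -fe -imset_comp.
exact: eq_imset.
Qed.

Section PartSections.

Variable d : nat.

(** The graph of [v]: [d] disjoint copies of [V] serve as the parts. *)
Definition part_section (V : finType) (v : {ffun 'I_d -> V}) : {set 'I_d * V} :=
  [set (i, v i) | i : 'I_d].

Lemma mem_part_section (V : finType) (v : {ffun 'I_d -> V}) i x :
  ((i, x) \in part_section v) = (x == v i).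
Proof.
apply/imsetP/eqP => [[j _ [-> ->]] //|->]; by exists i.
Qed.

Lemma part_section_inj (V : finType) : injective (@part_section V).
Proof.
move=> v w vw; apply/ffunP => i; apply/eqP.
by rewrite -mem_part_section -vw mem_part_section.
Qed.

Lemma part_section_complete_partite t (e : {ffun 'I_d -> 'I_t}) :
  part_section e \in complete_partite d t.
Proof.
rewrite inE; apply/forallP => i; apply/cards1P; exists (i, e i).
apply/setP => -[j x]; rewrite !inE mem_part_section /= -pair_eqE /=.
by case: (j =P i) => [->|]; rewrite ?andbT ?andbF.
Qed.

Lemma uniform_part_sections (V : finType) (A : {set {ffun 'I_d -> V}}) :
  uniform d (@part_section V @: A).
Proof.
apply/forall_inP => _ /imsetP[v _ ->].
by rewrite card_imset ?card_ord // => i j [].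
Qed.

(* Replacing one vertex of an edge by its twin only moves one of the [d] parts
   hit, so the two twins are sent to the same part. *)
Lemma copy_complete_partite (V : finType) t (A : {set {ffun 'I_d -> V}}) :
    contains_copy (complete_partite d t.+1) (@part_section V @: A) ->
  exists2 x : 'I_d -> 'I_t.+1 -> V, (forall i, injective (x i)) &
    forall e : {ffun 'I_d -> 'I_t.+1}, [ffun i => x i (e i)] \in A.
Proof.
case/existsP => f /andP[/injectiveP fI /forall_inP fA].
have fP (e : {ffun 'I_d -> 'I_t.+1}) :
    exists2 v, v \in A & f @: part_section e = part_section v.
  by have /imsetP[v] := fA _ (part_section_complete_partite e); exists v.
have vert (e : {ffun 'I_d -> 'I_t.+1}) v j : f @: part_section e = part_section v ->
    exists i, f (i, e i) = (j, v j).
  move=> fe; have : (j, v j) \in part_section v by rewrite mem_part_section.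
  by rewrite -fe => /imsetP[_ /imsetP[i _ ->] ->]; exists i.
have onto (e : {ffun 'I_d -> 'I_t.+1}) j : exists i, (f (i, e i)).1 == j.
  have [v _ fe] := fP e; have [i fi] := vert _ _ j fe.
  by exists i; rewrite fi.
have part_bij (e : {ffun 'I_d -> 'I_t.+1}) : bijective (fun i => (f (i, e i)).1).
  pose k j := xchoose (onto e j).
  have kK : cancel k (fun i => (f (i, e i)).1).
    by move=> j; apply/eqP/(xchooseP (onto e j)).
  have [k' k'K kK'] := injF_bij (can_inj kK).
  have E i : (f (i, e i)).1 = k' i by rewrite -{1 2}(kK' i) kK.
  by exists k => // i; rewrite E kK'.
have same i b b' : (f (i, b)).1 = (f (i, b')).1.
  pose e := [ffun _ : 'I_d => b].
  pose e' := [ffun j => if j == i then b' else b].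
  (* If [e] met the part of [f (i, b')] at some [j] other than [i], then [e'] would meet it at both
     [i] and [j]. *)
  have [j /eqP] := onto e (f (i, b')).1.
  have [->|ji] := eqVneq j i; first by rewrite ffunE.
  move=> E; have /bij_inj/(_ j i) := part_bij e'.
  rewrite /= !ffunE (negbTE ji) eqxx; move: E; rewrite ffunE => -> /(_ erefl) ji'.
  by rewrite ji' eqxx in ji.
have [k' k'K kK'] := part_bij [ffun=> ord0].
have partE i b : (f (i, b)).1 = (f (i, [ffun _ : 'I_d => ord0 : 'I_t.+1] i)).1.
  exact: same.
exists (fun j b => (f (k' j, b)).2) => [j b b' E|e].
  have : f (k' j, b) = f (k' j, b').
    by apply/eqP; rewrite -pair_eqE /= (same _ b b') E !eqxx.
  by move/fI => [].
(* [e] is indexed by target parts, so it is pulled back along the permutation of parts. *)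
pose e' := [ffun i => e (f (i, ord0)).1].
have [v vA fe] := fP e'.
suff -> : [ffun i => (f (k' i, e i)).2] = v by [].
apply/ffunP => j; rewrite ffunE.
have [i fi] := vert _ _ j fe.
have ij : (f (i, ord0)).1 = j by rewrite (same _ _ (e' i)) fi.
have kj : k' j = i.
  by rewrite -{1}ij partE k'K.
by rewrite kj -{1}ij; move: fi; rewrite ffunE => ->.
Qed.

End PartSections.

(** * The bound for fields of order [2^k], and the choice of [k] *)

Lemma turan_ex_box_ge (d r s k n : nat) :
    (0 < r)%N -> (0 < s)%N -> (d * (s - 1) < (2 ^ d - 1) * r)%N ->
    (2 * d < k)%N -> (d * (2 ^ k) ^ s <= n)%N ->
  ((2 ^ k) ^ (s * d) <=
     2 ^ d.+1 * (2 ^ k) ^ r * turan_ex d n (complete_partite d 2))%N.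
Proof.
move=> r0 s0 drs dk dn.
have [|F _ cF] := @pPrimePowerField 2 k isT; first by apply: leq_trans dk.
pose a : 'rV[F]_r := const_mx 1.
have a0 : a != 0.
  apply/eqP => /rowP/(_ (Ordinal r0)); rewrite !mxE => /eqP.
  by rewrite oner_eq0.
have [|C] := exists_many_good_edges a0 s0 drs.
  by rewrite cF leq_exp2l.
rewrite cF => /leq_trans; apply; rewrite leq_mul2l; apply/orP; right.
set A := (_ :\: _).
rewrite -(card_imset _ (@part_section_inj d _)).
apply: turan_ex_ge.
- by rewrite card_prod card_ord card_mx mul1n cF.
- move=> [i b]; exists (part_section [ffun=> b]).
    exact: part_section_complete_partite.
  by rewrite mem_part_section ffunE.
- exact: uniform_part_sections.
apply/negP => /copy_complete_partite[x xI xA].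
(* A copy is itself a box, so its base corner is a bad edge and was deleted. *)
have : [ffun i => x i ([ffun=> 0] i)] \notin A.
  rewrite inE negb_and negbK; apply/orP; left.
  apply/imsetP; exists [ffun i => \matrix_b x i b].
    apply/boxesP; split=> [i|e].
      by rewrite ffunE !rowK; apply/eqP => /xI.
    have := xA e; rewrite !inE => /andP[_ /eqP <-].
    by apply: eq_mleval => i; rewrite !ffunE rowK.
  by apply/ffunP => i; rewrite !ffunE rowK.
by rewrite xA.
Qed.

(** The largest [k] with [d * (2 ^ k) ^ s <= n] works: by maximality only a factor [2 ^ s] is
    lost. *)
Lemma exists_power2_scale (d s m n : nat) :
    (0 < d)%N -> (0 < s)%N -> (d * (2 ^ m) ^ s <= n)%N ->
  exists2 k, (m <= k)%N & (d * (2 ^ k) ^ s <= n <= d * 2 ^ s * (2 ^ k) ^ s)%N.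
Proof.
move=> d0 s0 mn; pose x := (n %/ d)%N.
have b1 : (1 < 2 ^ s)%N by rewrite -{1}(expn0 2) ltn_exp2l.
have mx : ((2 ^ s) ^ m <= x)%N by rewrite leq_divRL // mulnC expnAC.
have x0 : (0 < x)%N by apply: leq_trans mx; rewrite expn_gt0 ltnW.
exists (trunc_log (2 ^ s) x); first exact: trunc_log_max.
have /andP[lo hi] := trunc_log_bounds b1 x0.
rewrite expnAC; apply/andP; split.
  by rewrite mulnC -leq_divRL.
by rewrite -mulnA -expnS mulnC ltnW // -ltn_divLR.
Qed.

(* The asymptotic statement over the reals *)
From mathcomp Require Import all_classical all_reals all_analysis.
Import Order.TTheory GRing.Theory Num.Theory.
Import numFieldNormedType.Exports.
Local Open Scope classical_set_scope.
Local Open Scope ring_scope.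

Theorem theorem2 (R : realType) (d r s : nat)
  (d_ge2 : (2 <= d)%N) (r_gt0 : (0 < r)%N) (s_gt0 : (0 < s)%N)
  (drs : (d * (s - 1) < (2 ^ d - 1) * r)%N) :
  (fun n : nat => (turan_ex d n (complete_partite d 2))%:R : R)
    \is 'Omega_\oo (fun n : nat => n%:R `^ (d%:R - r%:R / s%:R) : R).
Proof.
have d_gt0 : (0 < d)%N by apply: ltnW.
pose D := (d * 2 ^ s)%N.
have D_gt0 : 0 < D%:R :> R by rewrite ltr0n muln_gt0 d_gt0 expn_gt0.
rewrite qualifE /=; apply/asboolP.
(* [2 ^+ d.+1] comes from the deletion bound, [D ^+ d] from [n <= D * q ^+ s]. *)
exists (2 ^+ d.+1 * D%:R ^+ d)^-1.
  by rewrite invr_gt0 mulr_gt0 ?exprn_gt0.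
(* This threshold forces [2 * d < k], the field size that deletion requires. *)
exists (d * (2 ^ (2 * d).+1) ^ s)%N => // n /= n_big.
have [k k_gt /andP[lo hi]] := exists_power2_scale d_gt0 s_gt0 n_big.
have := turan_ex_box_ge r_gt0 s_gt0 drs k_gt lo.
set X := turan_ex _ _ _; set q := (2 ^ k)%N => ex_ge.
have q_gt0 : 0 < q%:R :> R by rewrite ltr0n expn_gt0.
have qs_le : q%:R ^+ s <= n%:R :> R.
  by rewrite -natrX ler_nat (leq_trans _ lo) // leq_pmull.
have n_gt0 : 0 < n%:R :> R by apply: lt_le_trans qs_le; rewrite exprn_gt0.
have n_le : n%:R <= D%:R * q%:R ^+ s :> R by rewrite -natrX -natrM ler_nat.
rewrite ger0_norm ?powR_ge0 // ger0_norm //.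
rewrite powRB; last by rewrite (gt_eqF n_gt0) implybT.
rewrite powR_mulrn //.
have root_ge : q%:R ^+ r <= n%:R `^ (r%:R / s%:R) :> R.
  have -> : q%:R ^+ r = (q%:R ^+ s) `^ (r%:R / s%:R) :> R.
    rewrite -!powR_mulrn // -powRrM mulrC divfK //.
    by rewrite pnatr_eq0 -lt0n.
  apply: ge0_ler_powR; rewrite ?nnegrE ?divr_ge0 ?exprn_ge0 //.
have pow_le : n%:R ^+ d <= D%:R ^+ d * q%:R ^+ (s * d) :> R.
  by rewrite exprM -exprMn lerXn2r ?nnegrE ?mulr_ge0 ?exprn_ge0.
rewrite ler_pdivrMl ?mulr_gt0 ?exprn_gt0 //.
rewrite ler_pdivrMr ?powR_gt0 //.
apply: (le_trans pow_le).
have ex_geR : q%:R ^+ (s * d) <= 2 ^+ d.+1 * q%:R ^+ r * X%:R :> R.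
  by rewrite -!natrX -!natrM ler_nat.
have Dd_ge0 : 0 <= D%:R ^+ d :> R by rewrite exprn_ge0.
apply: (le_trans (ler_wpM2l Dd_ge0 ex_geR)).
rewrite [X in _ <= X](_ : _ =
  D%:R ^+ d * (2 ^+ d.+1 * n%:R `^ (r%:R / s%:R) * X%:R)); last by ring.
rewrite ler_wpM2l // ler_wpM2r //.
by rewrite ler_wpM2l ?exprn_ge0.
Qed.
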